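(* Let $T$ be a (finite) tree with diameter $d$. Then $m_{T}[0,1)\geq (d+1)/3$.
   Context: For a graph $G$ on $n$ vertices, the Laplacian matrix is $L(G)=D(G)-A(G)$, where $D(G)$ is the diagonal degree matrix and $A(G)$ the adjacency matrix; its eigenvalues (with multiplicity) are the Laplacian eigenvalues of $G$. For an interval $I$, $m_{G}I$ denotes the number of Laplacian eigenvalues of $G$ (counted with multiplicity) lying in $I$; thus $m_G[0,1)$ is the number of Laplacian eigenvalues of $G$ that are less than $1$. *)

(* Defs.v *)
From mathcomp Require Import all_boot all_order all_algebra.
From mathcomp Require Import polyrcf.

Set Implicit Arguments.
Unset Strict Implicit.
Unset Printing Implicit Defensive.

Import Order.TTheory GRing.Theory Num.Theory.

Local Open Scope ring_scope.

Record sgraph := SGraph {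
  vertex :> finType;
  edge : rel vertex;
  edge_sym : symmetric edge;
  edge_irrefl : irreflexive edge }.

Arguments edge {s}.

Section Graphs.
Variable G : sgraph.

Definition connected := forall x y : G, connect edge x y.

(* A list [:: x; y] with x, y adjacent is a (degenerate) ucycle, so the cycles
   of the graph are the ucycles with at least three vertices. *)
Definition acyclic := forall c : seq G, ucycle edge c -> (size c < 3)%N.

Definition is_tree := [/\ (0 < #|G|)%N, connected & acyclic].

Definition walk_of_length (x y : G) (k : nat) : bool :=
  [exists p : k.-tuple G, path edge x p && (last x p == y)].

(* A shortest walk has fewer than #|G| edges; the value is #|G| when x and y are
   not connected. *)
Definition dist (x y : G) : nat := find (walk_of_length x y) (iota 0 #|G|).

Definition diameter : nat := (\max_(x : G) \max_(y : G) dist x y)%N.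

Definition degree (x : G) : nat := #|[set y : G | edge x y]|.

Lemma distP (x y : G) : connect edge x y ->
  walk_of_length x y (dist x y) /\
  forall k, walk_of_length x y k -> (dist x y <= k)%N.
Proof.
move=> /connectP[p0 /shortenP[p pp up _ {p0}] ->].
set z := last x p.
have sp : (size p < #|G|)%N by have := max_card [in x :: p]; rewrite (card_uniqP up).
have wp : walk_of_length x z (size p).
  by apply/existsP; exists (in_tuple p); rewrite pp eqxx.
have hw : has (walk_of_length x z) (iota 0 #|G|).
  by apply/hasP; exists (size p); rewrite // mem_iota.
have lt : (dist x z < #|G|)%N by move: hw; rewrite has_find size_iota.
split; first by have := nth_find 0%N hw; rewrite nth_iota.
move=> k wk; rewrite leqNgt; apply/negP => kd.
have := before_find 0%N kd; rewrite nth_iota ?add0n ?wk //.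
exact: ltn_trans lt.
Qed.

Section Laplacian.
Variable R : rcfType.

Definition degree_mx : 'M[R]_#|G| :=
  diag_mx (\row_i (degree (enum_val i))%:R).

Definition adjacency_mx : 'M[R]_#|G| :=
  \matrix_(i, j) (edge (enum_val i) (enum_val j))%:R.

Definition laplacian : 'M[R]_#|G| := degree_mx - adjacency_mx.

(* rootsR lists the distinct real roots; mup x is the multiplicity of the root x. *)
Definition laplacian_eigen_count (I : interval R) : nat :=
  (\sum_(x <- rootsR (char_poly laplacian) | x \in I)
      mup x (char_poly laplacian))%N.

End Laplacian.
End Graphs.

(* Main.v *)
Require Import Defs.
From mathcomp Require Import all_boot all_order all_algebra.
From mathcomp Require Import polyrcf complex zify.
Import Order.TTheory GRing.Theory Num.Theory.
Set Implicit Arguments.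
Unset Strict Implicit.
Unset Printing Implicit Defensive.
Local Open Scope ring_scope.
Local Open Scope sesquilinear_scope.

(** A Hermitian form that is nonpositive on a [k]-dimensional space meeting its
kernel trivially has at least [k] negative eigenvalues; we apply this to [L - 1].
Take a simple path [v 0, ..., v l] of the tree with [l] at least the diameter.
Cutting the edges of the path splits the tree into one piece around each [v i],
and a vector constant on the pieces has, off the path, zero Laplacian and, on the
path, the Laplacian of the path. It is therefore enough to treat the path, where
the vectors with values [u0, 0, u1, u1, 0, u2, u2, 0, ...] form a space of
dimension [l %/ 3 + 1] with the required properties: vertex by vertex,
[(L - 1) a] times the conjugate of [a] is [0], or [- |a|^2] at the last vertex. *)

(** * Characteristic polynomials and root counting *)

Lemma char_poly_conj (R : comUnitRingType) n (P A : 'M[R]_n) :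
  P \in unitmx -> char_poly (invmx P *m A *m P) = char_poly A.
Proof.
move=> uP; rewrite /char_poly /char_poly_mx.
set Q := map_mx (@polyC R) P.
have QVQ : map_mx (@polyC R) (invmx P) *m Q = 1%:M.
  by rewrite -map_mxM mulVmx // map_mx1.
have -> : 'X%:M - map_mx polyC (invmx P *m A *m P) =
    map_mx polyC (invmx P) *m ('X%:M - map_mx polyC A) *m Q.
  by rewrite !map_mxM mulmxBr mulmxBl scalar_mxC -(mulmxA _%:M) QVQ mulmx1.
by rewrite !det_mulmx mulrAC -det_mulmx QVQ det1 mul1r.
Qed.

Lemma char_poly_diag_mx (R : comNzRingType) n (d : 'rV[R]_n) :
  char_poly (diag_mx d) = \prod_i ('X - (d 0 i)%:P).
Proof.
rewrite char_poly_trig ?diag_mx_is_trig //.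
by apply: eq_bigr => i _; rewrite !mxE eqxx.
Qed.

(** This turns the eigenvalue count into a count on an explicit list. It is a double counting: the
    multiplicity of a root is its number of occurrences in [s], and after exchanging the sums each
    entry of [s] in [I] is met exactly once among the distinct roots. *)
Lemma sum_mup_rootsR_prod (R : rcfType) (I : interval R) (s : seq R)
    (p := \prod_(x <- s) ('X - x%:P)) :
  (\sum_(x <- rootsR p | x \in I) mup x p)%N = count [in I] s.
Proof.
have p0 : p != 0 by rewrite monic_neq0 // monic_prod_XsubC.
have rE x : (x \in rootsR p) = (x \in s).
  by rewrite -(roots_on_rootsR p0) root_prod_XsubC.
rewrite (eq_bigr (fun x => count_mem x s)); last first.
  by move=> x _; rewrite mu_prod_XsubC.
have -> : count [in I] s = (\sum_(y <- s | y \in I) 1)%N by rewrite sum1_count.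
under eq_bigr do rewrite -sum1_count.
rewrite (exchange_big_dep [in I]) /=; last by move=> x y xI /eqP->.
rewrite [LHS]big_seq_cond [RHS]big_seq_cond; apply: eq_bigr => y /andP[ys yI].
rewrite sum1_count (eq_count (a2 := pred1 y)); last first.
  by move=> x /=; rewrite eq_sym; case: eqP => [->|]; rewrite ?andbF // yI.
have /count_uniq_mem -> : uniq (rootsR p).
  by apply: lt_sorted_uniq; apply: sorted_roots.
by rewrite rE ys.
Qed.

(** * Negative eigenvalues of Hermitian matrices *)

Lemma hermitian_form_diag (C : numClosedFieldType) n (d y : 'rV[C]_n) :
  (y *m diag_mx d *m y ^t* ) 0 0 = \sum_i d 0 i * `|y 0 i| ^+ 2.
Proof.
rewrite mxE; apply: eq_bigr => i _.
by rewrite mul_mx_diag !mxE mulrAC normCK mulrC.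
Qed.

(** There are fewer linear conditions than unknowns: the columns of [Y] selected by [P] form a
    matrix whose left kernel has dimension at least [k - #|P|]. *)
Lemma exists_ker_row (F : fieldType) k n (Y : 'M[F]_(k, n)) (P : pred 'I_n) :
  (#|P| < k)%N -> exists2 u : 'rV_k, u != 0 & forall i, P i -> (u *m Y) 0 i = 0.
Proof.
move=> ltPk; pose Y' : 'M[F]_(k, #|P|) := \matrix_(i, j) Y i (enum_val j).
have: kermx Y' != 0.
  rewrite -mxrank_eq0 mxrank_ker -lt0n subn_gt0.
  exact: leq_ltn_trans (rank_leq_col _) ltPk.
case/rowV0Pn => u /sub_kermxP uY u0; exists u => // i Pi.
move/rowP/(_ (enum_rank_in Pi i)): uY; rewrite !mxE => uYi; rewrite -[RHS]uYi.
by apply: eq_bigr => j _; rewrite mxE enum_rankK_in.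
Qed.

(* Were there fewer than [k] negative eigenvalues, some nonzero [u *m Z] would
   be orthogonal to all their eigenvectors; the form is then both nonnegative
   and nonpositive at [u *m Z], so that [u *m Z] lies in the kernel of [A]. *)
Lemma hermitian_negative_count_ge (C : numClosedFieldType) n k
    (P : 'M[C]_n) (d : 'rV[C]_n) (Z : 'M[C]_(k, n))
    (A := invmx P *m diag_mx d *m P) :
  P \is unitarymx -> d \is a mxOver Num.real ->
  (forall u : 'rV_k, (u *m Z *m A *m (u *m Z) ^t* ) 0 0 <= 0) ->
  (forall u : 'rV_k, u *m Z *m A = 0 -> u = 0) ->
  (k <= #|[pred i | (d 0 i < 0)%R]|)%N.
Proof.
move=> uP dR neg inj; rewrite leqNgt; apply/negP => ltk.
have [u u0 uY] := exists_ker_row (Z *m invmx P) ltk.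
case/eqP: u0; apply: inj; move: (neg u).
set y := u *m (Z *m invmx P) in uY.
have yE : u *m Z *m invmx P = y by rewrite /y mulmxA.
have -> : u *m Z *m A *m (u *m Z) ^t* = y *m diag_mx d *m y ^t*.
  rewrite -[in (u *m Z) ^t*](mulmxKV (unitarymx_unit uP) (u *m Z)) yE.
  by rewrite trmx_mul map_mxM /A !mulmxA yE mulmxtVK.
rewrite hermitian_form_diag => sum_le0.
have ge0 i : 0 <= d 0 i * `|y 0 i| ^+ 2.
  have dRi : d 0 i \is Num.real by apply: (mxOverP dR).
  have [d0|d0] := real_leP (real0 _) dRi; first by rewrite mulr_ge0 ?exprn_ge0.
  by rewrite uY // normr0 expr0n mulr0.
have /eqP : \sum_i d 0 i * `|y 0 i| ^+ 2 = 0.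
  by apply/le_anti; rewrite sum_le0 sumr_ge0.
rewrite psumr_eq0 // => /allP all0.
rewrite /A !mulmxA yE; suff -> : y *m diag_mx d = 0 by rewrite mul0mx.
apply/rowP => i; rewrite mul_mx_diag [LHS]mxE [RHS]mxE.
have /implyP/(_ isT) := all0 i (mem_index_enum _).
by rewrite mulf_eq0 expf_eq0 /= normr_eq0 => /orP[]/eqP->; rewrite ?(mul0r, mulr0).
Qed.

(** Over [R[i]] the matrix [M - c] is Hermitian, hence unitarily diagonalisable with real spectrum.
    Shifting this spectrum back by [c] gives [s], whose entries below [c] match the negative
    eigenvalues of [M - c]. *)
Lemma symmetric_eigen_count_ge (R : rcfType) n (M : 'M[R]_n) (c : R) :
  M^T = M -> exists2 s : seq R, char_poly M = \prod_(x <- s) ('X - x%:P) &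
  forall k (Z : 'M[R[i]]_(k, n))
      (A := map_mx (real_complex R) (M - c%:M)),
    (forall u : 'rV_k, (u *m Z *m A *m (u *m Z) ^t* ) 0 0 <= 0) ->
    (forall u : 'rV_k, u *m Z *m A = 0 -> u = 0) ->
  (k <= count (< c) s)%N.
Proof.
move=> symM; set toC := real_complex R.
pose B := map_mx toC (M - c%:M).
have Breal : B \is a mxOver Num.real.
  by apply/mxOverP => i j; rewrite mxE complex_real.
have Bherm : B \is hermsymmx.
  apply: realsym_hermsym Breal; apply/is_hermitianmxP.
  by rewrite expr0 scale1r map_mx_id // map_trmx linearB /= symM tr_scalar_mx.
have /orthomx_spectralP BE := hermitian_normalmx Bherm.
have dR := hermitian_spectral_diag_real Bherm.
have uP := spectral_unitarymx B.
set P := spectralmx B in BE uP; set d := spectral_diag B in BE dR.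
pose r i := complex.Re (d 0 i).
have dE i : d 0 i = toC (r i) by rewrite /r /toC RRe_real //; apply: (mxOverP dR).
exists [seq r i + c | i <- enum 'I_n].
  apply: (@map_poly_inj _ _ toC); rewrite map_char_poly.
  have -> : map_mx toC M = invmx P *m diag_mx (\row_i (d 0 i + toC c)) *m P.
    have -> : diag_mx (\row_i (d 0 i + toC c)) = diag_mx d + (toC c)%:M.
      by apply/matrixP => i j; rewrite !mxE -mulrnDl.
    rewrite mulmxDr mulmxDl -BE scalar_mxC -mulmxA mulVmx ?unitarymx_unit //.
    by rewrite mulmx1 /B map_mxB map_scalar_mx subrK.
  rewrite char_poly_conj ?unitarymx_unit // char_poly_diag_mx.
  rewrite big_map rmorph_prod big_enum /=; apply: eq_bigr => i _.
  by rewrite rmorphB /= map_polyX map_polyC mxE dE /toC -rmorphD.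
move=> k Z A neg inj; rewrite count_map.
have <- : #|[pred i | d 0 i < 0]| = count (preim (fun i => r i + c) (< c)) (enum 'I_n).
  rewrite cardE size_filter enumT; apply: eq_count => i /=.
  by rewrite inE dE /toC ltcR gtrDr.
by apply: (hermitian_negative_count_ge uP dR); rewrite -BE.
Qed.

(** * The Laplacian of a graph *)

Lemma laplacian_sym (G : sgraph) (R : rcfType) : (laplacian G R)^T = laplacian G R.
Proof.
rewrite /laplacian linearB /= tr_diag_mx; congr (_ - _).
by apply/matrixP => i j; rewrite !mxE edge_sym.
Qed.

(** The morphism [g] is the identity in the maximum principle and the embedding into [R[i]] in the
    Hermitian form. *)
Lemma mulmx_map_laplacian (G : sgraph) (R : rcfType) (C : comNzRingType)
    (g : {rmorphism R -> C}) (z : 'rV[C]_#|G|) (x : G) :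
  (z *m map_mx g (laplacian G R)) 0 (enum_rank x) =
  \sum_(y | edge x y) (z 0 (enum_rank x) - z 0 (enum_rank y)).
Proof.
rewrite map_mxB mulmxBr [LHS]mxE [X in _ + X]mxE sumrB; congr (_ - _).
  rewrite map_diag_mx mul_mx_diag !mxE enum_rankK rmorph_nat mulr_natr.
  by rewrite -sumr_const; apply: eq_bigl => y; rewrite inE.
rewrite mxE (reindex_onto enum_rank enum_val) /=; last by move=> i _; rewrite enum_valK.
rewrite big_mkcond [RHS]big_mkcond; apply: eq_bigr => y _.
rewrite enum_rankK eqxx !mxE !enum_rankK rmorph_nat mulr_natr edge_sym.
by case: (edge x y).
Qed.

(* Maximum principle, at a vertex where an eigenvector is largest in absolute value. *)
Lemma laplacian_root_ge0 (G : sgraph) (R : rcfType) (l : R) :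
  root (char_poly (laplacian G R)) l -> 0 <= l.
Proof.
rewrite -eigenvalue_root_char => /eigenvalueP[v vL v0].
pose f (x : G) := v 0 (enum_rank x).
have [x0 fx0] : exists x, f x != 0.
  case/rV0Pn: v0 => i vi; exists (enum_val i).
  by rewrite /f enum_valK.
have [x _ xmax] := Order.TotalTheory.arg_maxP (i0 := x0) (P := xpredT) (fun x => `|f x|) isT.
have fx_gt0 : 0 < f x ^+ 2.
  rewrite -real_normK ?num_real // exprn_gt0 //.
  by rewrite (lt_le_trans _ (xmax x0 isT)) ?normr_gt0.
rewrite -(pmulr_lge0 _ fx_gt0) expr2 mulrA.
have <- : \sum_(y | edge x y) (f x - f y) = l * f x.
  rewrite -(mulmx_map_laplacian (idfun : {rmorphism R -> R})) map_mx_id //.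
  by rewrite vL mxE.
rewrite mulr_suml sumr_ge0 // => y _; rewrite mulrBl subr_ge0.
apply: le_trans (ler_norm _) _; rewrite normrM -expr2 -[f x ^+ 2]real_normK ?num_real //.
by rewrite expr2 ler_wpM2r //; apply: xmax.
Qed.

(** * Simple paths and the retraction onto them *)

Section Retraction.
Variables (G : sgraph) (v : nat -> G) (l : nat).
Hypothesis acycG : acyclic G.
Hypothesis v_edge : forall i, (i < l)%N -> edge (v i) (v i.+1).
Hypothesis v_inj : {in [pred i | (i <= l)%N] &, injective v}.

Definition cut_edge (x y : G) : rel G := fun a b =>
  edge a b && ~~ ((a == x) && (b == y) || (a == y) && (b == x)).

Lemma cut_edge_sym x y : symmetric (cut_edge x y).
Proof.
by move=> a b; rewrite /cut_edge edge_sym orbC ![_ && (b == _)]andbC.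
Qed.

(** A simple path from [y] to [x] avoiding the edge would close up with it to a cycle. Acyclicity
    leaves only the lengths 0, excluded by irreflexivity, and 1, where the path is the removed edge
    itself. *)
Lemma acyclic_bridge x y : edge x y -> ~~ connect (cut_edge x y) y x.
Proof.
move=> exy; apply/negP => /connectP[p0 /shortenP[p pp up _ {p0}] xE].
have sub : subrel (cut_edge x y) edge by move=> a b /andP[].
have : (size (y :: p) < 3)%N.
  apply: acycG; rewrite /ucycle /ucycleb up andbT /= rcons_path (sub_path sub pp).
  by rewrite -xE.
case: p pp xE {up} => [|a [|//]] /=.
  by move=> _ xy; rewrite xy edge_irrefl in exy.
by move=> /andP[c _] xa _; move: c; rewrite /cut_edge xa !eqxx orbT andbF.
Qed.

Let side i x := connect (cut_edge (v i) (v i.+1)) (v i.+1) x.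

(** Cutting the edge [i] leaves both remaining segments of the path intact. For [j <= i], a
    connection from [v i.+1] to [v j] would continue to [v i], against the bridge property. *)
Lemma side_path i j : (i < l)%N -> (j <= l)%N -> side i (v j) = (i < j)%N.
Proof.
move=> il jl.
have veq a b : (a <= l)%N -> (b <= l)%N -> (v a == v b) = (a == b).
  move=> al bl; apply/eqP/eqP => [|->//]; exact: v_inj.
have cut a : (a < l)%N -> a != i -> cut_edge (v i) (v i.+1) (v a) (v a.+1).
  by move=> al ai; rewrite /cut_edge v_edge // !veq; lia.
have conn a b : (a <= b <= l)%N -> (forall c, a <= c < b -> c != i)%N ->
    connect (cut_edge (v i) (v i.+1)) (v a) (v b).
  elim: b => [|b IHb] abl ci; first by have -> : a = 0%N by lia.
  have [->//|ab] := eqVneq a b.+1.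
  apply: connect_trans (IHb _ _) _; [lia| |apply/connect1/cut].
  - by move=> c ?; apply: ci; lia.
  - lia.
  - by apply: ci; lia.
have [ij|ji] := ltnP i j; first by apply: conn => [|c]; lia.
apply/negP => ij; have /negP := acyclic_bridge (v_edge il); apply.
by apply: connect_trans ij _; apply: conn => [|c]; lia.
Qed.

(** Take for [phi x] the number of path edges beyond which [x] lies. If [phi] changes along an edge,
    its ends are on different sides of some cut [i], so the edge does not survive that cut and is
    the path edge [i]. *)
Lemma path_retraction : exists phi : G -> nat,
  [/\ forall x, (phi x <= l)%N, forall j, (j <= l)%N -> phi (v j) = j &
      forall x y, edge x y -> phi x != phi y -> exists2 i, (i < l)%N &
        (x = v i /\ y = v i.+1) \/ (x = v i.+1 /\ y = v i)].
Proof.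
exists (fun x => \sum_(i < l) side i x)%N; split=> [x|j jl|x y exy].
- rewrite -[leqRHS]card_ord -sum1_card leq_sum // => i _.
  by case: (side i x).
- under eq_bigr => i _ do rewrite side_path //.
  rewrite (eq_bigr (fun i : 'I_l => if (i < j)%N then 1 else 0)%N); last first.
    by move=> i _; case: (i < j)%N.
  by rewrite -big_mkcond -(big_ord_widen l (fun=> 1%N)) // sum1_card card_ord.
- case: (boolP [forall i : 'I_l, side i x == side i y]) => [/forallP e|].
    by under eq_bigr => i _ do rewrite (eqP (e i)); rewrite eqxx.
  case/forallPn => i nside _; exists i => //.
  have : ~~ cut_edge (v i) (v i.+1) x y.
    apply: contra nside => c; rewrite /side.
    apply/eqP/same_connect_r; last exact: connect1.
    exact/sym_connect_sym/cut_edge_sym.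
  by rewrite /cut_edge exy negbK => /orP[]/andP[/eqP-> /eqP->]; [left|right].
Qed.

End Retraction.

(** Join two vertices at maximal distance by a simple path: its length is at least their distance,
    by minimality of the latter. *)
Lemma tree_long_path (G : sgraph) : is_tree G -> exists l (v : nat -> G),
  [/\ (diameter G <= l)%N, forall i, (i < l)%N -> edge (v i) (v i.+1) &
      {in [pred i | (i <= l)%N] &, injective v}].
Proof.
case=> G0 conG _; rewrite /diameter.
have [x ->] := bigop.eq_bigmax (fun x : G => \max_(y : G) dist x y)%N G0.
have [y ->] := bigop.eq_bigmax (dist x) G0.
have [wxy dmin] := distP (conG x y).
case/existsP: wxy => p0 /andP[/shortenP[p pp up _ ] /eqP yE].
exists (size p), (fun i => nth x (x :: p) i); split.
- by apply: dmin; apply/existsP; exists (in_tuple p); rewrite pp yE eqxx.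
- by move=> i ip; exact: (pathP x pp).
- by move=> i j il jl /eqP; rewrite nth_uniq // => /eqP.
Qed.

(** * Test vectors on a path *)

Section PathVector.
Variables (C : numClosedFieldType) (l : nat) (a : nat -> C).
Hypothesis a_mod1 : forall b, (b %% 3 = 1)%N -> a b = 0.
Hypothesis a_mod2 : forall b, (b %% 3 = 2)%N -> a b.+1 = a b.
Hypothesis a_last : (l %% 3 = 2)%N -> a l = 0.

Definition path_laplacian b : C :=
  (if (0 < b)%N then a b - a b.-1 else 0) +
  (if (b < l)%N then a b - a b.+1 else 0).

(** A nonzero entry has a zero neighbour on one side and, on the other, an equal neighbour or none,
    so the Laplacian reproduces it. The exception is [b = l] divisible by 3: the zero neighbour is
    missing and the Laplacian vanishes. *)
Lemma path_form_le0 b : (b <= l)%N -> (path_laplacian b - a b) * (a b)^* <= 0.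
Proof.
move=> bl.
have : [|| b %% 3 == 0, b %% 3 == 1 | b %% 3 == 2]%N by lia.
case/or3P => /eqP b3.
- have -> : path_laplacian b = if (b < l)%N then a b else 0.
    rewrite /path_laplacian [X in X + _](_ : _ = 0) ?add0r; last first.
      by case: b b3 {bl} => //= b b3; rewrite a_mod2 ?subrr //; lia.
    by rewrite [a b.+1]a_mod1 ?subr0 //; lia.
  case: ifP => _; first by rewrite subrr mul0r.
  by rewrite sub0r mulNr -normCK oppr_le0 exprn_ge0.
- by rewrite a_mod1 // conjC0 mulr0.
- have [bl'|lb] := ltnP b l; last first.
    have bE : b = l by lia.
    by rewrite bE a_last -?bE // conjC0 mulr0.
  rewrite /path_laplacian bl' a_mod2 // subrr addr0.
  case: b b3 {bl bl'} => //= b b3.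
  by rewrite [a b]a_mod1 ?subr0 ?subrr ?mul0r //; lia.
Qed.

(** The equation at [l] gives [a l.-1 = 0], the pattern modulo 3 then gives [a l = 0], and the
    recurrence propagates zeros leftwards. For [l] equal to 2 modulo 3 the path does have eigenvalue
    1, with eigenvector 1, 0, -1, -1, 0, 1, ...; [a_last] rules it out. *)
Lemma path_kernel_eq0 : (forall b, (b <= l)%N -> path_laplacian b = a b) ->
  forall b, (b <= l)%N -> a b = 0.
Proof.
move=> ker.
have al1 : a l.-1 = 0.
  have := ker l (leqnn l); rewrite /path_laplacian ltnn addr0.
  case: (l) => [<-//|m] /= /eqP.
  by rewrite -subr_eq0 addrAC subrr sub0r oppr_eq0 => /eqP.
have al : a l = 0.
  have : [|| l %% 3 == 0, l %% 3 == 1 | l %% 3 == 2]%N by lia.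
  case/or3P => /eqP l3; [|exact: a_mod1|exact: a_last].
  by case: (l) al1 l3 => //= m am l3; rewrite a_mod2 //; lia.
have both m : (m <= l)%N -> a (l - m)%N = 0 /\ a (l - m).-1 = 0.
  elim: m => [|m IHm] ml; first by rewrite subn0.
  have [am am1] := IHm (ltnW ml); rewrite subnS am1; split=> //.
  (* At the left end [(l - m).-1] is 0 and equals its own truncated predecessor. *)
  have [m2l|lm] := ltnP m.+1 l; last first.
    by have -> : (l - m).-1.-1 = (l - m).-1 by lia.
  have bl : ((l - m).-1 <= l)%N by lia.
  have := ker _ bl; rewrite /path_laplacian !ifT; try lia.
  have -> : (l - m).-1.+1 = (l - m)%N by lia.
  by rewrite am am1 !sub0r oppr0 addr0 => /eqP; rewrite oppr_eq0 => /eqP.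
move=> b bl; have [+ _] := both (l - b)%N (leq_subr _ _).
by rewrite subKn.
Qed.

End PathVector.

(** * Pulling vectors back from the path to the graph *)

Section Pullback.
Variables (G : sgraph) (v : nat -> G) (l : nat) (phi : G -> nat).
Hypothesis v_edge : forall i, (i < l)%N -> edge (v i) (v i.+1).
Hypothesis phi_v : forall j, (j <= l)%N -> phi (v j) = j.
Hypothesis phi_edge : forall x y, edge x y -> phi x != phi y -> exists2 i, (i < l)%N &
  (x = v i /\ y = v i.+1) \/ (x = v i.+1 /\ y = v i).
Variables (C : numClosedFieldType) (a : nat -> C).

(** An edge along which [phi] changes has both ends on the path, so [phi] is constant along every
    edge at [x]. *)
Lemma pullback_laplacian_off x : x != v (phi x) ->
  \sum_(y | edge x y) (a (phi x) - a (phi y)) = 0.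
Proof.
move=> xv; apply: big1 => y exy.
have [->|/(phi_edge exy)[i il [[xE _]|[xE _]]]] := eqVneq (phi x) (phi y).
- by rewrite subrr.
- by rewrite xE phi_v ?eqxx // ltnW in xv.
- by rewrite xE phi_v ?eqxx in xv.
Qed.

Lemma pullback_laplacian_on b : (b <= l)%N ->
  \sum_(y | edge (v b) y) (a b - a (phi y)) = path_laplacian l a b.
Proof.
move=> bl; rewrite big_mkcond.
(* Only the path edges at [v b] contribute; one indicator for each makes the sum collapse to at most
   two terms. *)
rewrite (eq_bigr (fun y =>
  (if (0 < b)%N && (y == v b.-1) then a b - a b.-1 else 0) +
  (if (b < l)%N && (y == v b.+1) then a b - a b.+1 else 0))); last first.
  move=> y _; case: ifP => [eby|neby].
    have [phiy|nphi] := eqVneq (phi y) b.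
      rewrite phiy subrr !ifF ?addr0 //; apply/negP => /andP[b0 /eqP yE];
        move: phiy; rewrite yE phi_v; lia.
    have := phi_edge eby; rewrite phi_v // eq_sym => /(_ nphi)[i il].
    case=> -[vb yE].
      have bi : b = i by rewrite -(phi_v bl) vb phi_v // ltnW.
      rewrite ifF ?ifT ?add0r ?yE ?bi ?il ?eqxx ?phi_v //.
      apply/negP => /andP[b0 /eqP] /(congr1 phi); rewrite !phi_v; lia.
    have bi : b = i.+1 by rewrite -(phi_v bl) vb phi_v.
    rewrite [X in _ = _ + X]ifF ?ifT ?addr0 ?yE ?bi ?eqxx ?phi_v //; try lia.
    apply/negP => /andP[b0 /eqP] /(congr1 phi); rewrite !phi_v; lia.
  rewrite !ifF ?addr0 //; apply/negP => /andP[b0 /eqP yE]; move: neby;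
    rewrite yE ?v_edge // edge_sym.
  by have := v_edge (i := b.-1); rewrite (prednK b0) => -> //; lia.
rewrite big_split /path_laplacian; congr (_ + _).
  by case: (0 < b)%N; rewrite /= -?big_mkcond ?big_pred1_eq // big1_eq.
by case: (b < l)%N; rewrite /= -?big_mkcond ?big_pred1_eq // big1_eq.
Qed.

End Pullback.

(* The vectors [a] on the path [0, ..., l] vanishing at [1, 4, 7, ...] and taking
   a common value [u j] at [3 j - 1] and [3 j]. *)
Definition triple_vector (F : nzRingType) k (u : 'rV[F]_k) (b : nat) : F :=
  \sum_j u 0 j * ((b %% 3 != 1) && (b.+1 %/ 3 == j))%N%:R.

Lemma triple_vector_mod1 (F : nzRingType) k (u : 'rV[F]_k) b :
  (b %% 3 = 1)%N -> triple_vector u b = 0.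
Proof. by move=> b3; apply: big1 => j _; rewrite b3 mulr0. Qed.

Lemma triple_vector_mod2 (F : nzRingType) k (u : 'rV[F]_k) b :
  (b %% 3 = 2)%N -> triple_vector u b.+1 = triple_vector u b.
Proof.
move=> b3; apply: eq_bigr => j _.
have -> : (b.+2 %/ 3 = b.+1 %/ 3)%N by lia.
by have -> : (b.+1 %% 3 != 1)%N = (b %% 3 != 1)%N by lia.
Qed.

Lemma triple_vector_ge (F : nzRingType) k (u : 'rV[F]_k) b :
  (k <= b.+1 %/ 3)%N -> triple_vector u b = 0.
Proof.
move=> kb; apply: big1 => j _.
have -> : (b.+1 %/ 3 == j)%N = false by have := ltn_ord j; lia.
by rewrite andbF mulr0.
Qed.

Lemma triple_vectorM3 (F : nzRingType) k (u : 'rV[F]_k) (j : 'I_k) :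
  triple_vector u (3 * j) = u 0 j.
Proof.
rewrite /triple_vector (bigD1 j) //= big1 ?addr0 => [|i ij].
  by rewrite [X in X%:R](_ : _ = 1%N) ?mulr1 //; lia.
rewrite [X in X%:R](_ : _ = 0%N) ?mulr0 //.
by have : (i : nat) != j by []; lia.
Qed.

(** * The eigenvalue bound *)

Lemma tree_eigen_count_ge (R : rcfType) (T : sgraph) l (v : nat -> T) :
  acyclic T -> (forall i, (i < l)%N -> edge (v i) (v i.+1)) ->
  {in [pred i | (i <= l)%N] &, injective v} ->
  (l %/ 3 < laplacian_eigen_count T `[(0 : R)%R, 1%R[)%N.
Proof.
move=> acT v_edge v_inj.
have [phi [phi_le phi_v phi_edge]] := path_retraction acT v_edge v_inj.
have [s sE count_ge] := symmetric_eigen_count_ge 1 (laplacian_sym T R).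
rewrite /laplacian_eigen_count sE sum_mup_rootsR_prod.
rewrite (eq_in_count (a2 := < 1)); last first.
  move=> x xs; rewrite /= in_itv /= (@laplacian_root_ge0 T) //.
  by rewrite sE root_prod_XsubC.
(* The rows are the basic triple vectors pulled back along [phi]. *)
pose Z : 'M[R[i]]_((l %/ 3).+1, #|T|) := \matrix_(j, x)
  ((phi (enum_val x) %% 3 != 1) && ((phi (enum_val x)).+1 %/ 3 == j))%N%:R.
have uZ u x : (u *m Z) 0 (enum_rank x) = triple_vector u (phi x).
  by rewrite mxE; apply: eq_bigr => j _; rewrite mxE enum_rankK.
have uZA u x : (u *m Z *m map_mx (real_complex R) (laplacian T R - 1%:M)) 0
    (enum_rank x) = \sum_(y | edge x y)
      (triple_vector u (phi x) - triple_vector u (phi y)) - triple_vector u (phi x).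
  rewrite map_mxB map_mx1 mulmxBr mulmx1 mxE mulmx_map_laplacian [X in _ + X]mxE uZ.
  by congr (_ - _); apply: eq_bigr => y _; rewrite uZ.
(* Here [l.+1 %/ 3] is [(l %/ 3).+1], just past the last coordinate of [u]. *)
have tlast u : (l %% 3 = 2)%N -> triple_vector (k := (l %/ 3).+1) u l = 0 :> R[i].
  by move=> l3; apply: triple_vector_ge; lia.
apply: (count_ge _ Z) => u.
  rewrite mxE (reindex_onto enum_rank enum_val) /=; last by move=> i _; rewrite enum_valK.
  rewrite big_mkcond -oppr_ge0 -sumrN sumr_ge0 //= => x _.
  rewrite enum_rankK eqxx uZA 2!mxE uZ oppr_ge0.
  have [xE|xv] := eqVneq x (v (phi x)); last first.
    rewrite (pullback_laplacian_off phi_v phi_edge) // sub0r mulNr.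
    by rewrite oppr_le0 -normCK exprn_ge0.
  have := pullback_laplacian_on v_edge phi_v phi_edge (triple_vector u) (phi_le x).
  rewrite -xE => ->.
  apply: path_form_le0 => //; first exact: triple_vector_mod1.
    exact: triple_vector_mod2.
  exact: tlast.
(* The coordinate [u 0 j] is read off at the path vertex [3 * j], which is at most [l] because
   [j <= l %/ 3]. *)
move=> uA0; apply/rowP => j; rewrite mxE -triple_vectorM3.
apply: (@path_kernel_eq0 _ l).
- exact: triple_vector_mod1.
- exact: triple_vector_mod2.
- exact: tlast.
- move=> b bl; rewrite -(pullback_laplacian_on v_edge phi_v phi_edge) //.
  have := uZA u (v b); rewrite uA0 mxE phi_v // => /esym/eqP.
  by rewrite subr_eq0 => /eqP.
- by have := ltn_ord j; lia.
Qed.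

Theorem theorem2 (R : rcfType) (T : sgraph) (d : nat)
    (treeT : is_tree T) (diamT : diameter T = d) :
  (d%:R + 1) / 3 <= (laplacian_eigen_count T `[(0 : R), 1[)%:R :> R.
Proof.
have [l [v [dl v_edge v_inj]]] := tree_long_path treeT.
have [_ _ acT] := treeT.
have := tree_eigen_count_ge R acT v_edge v_inj; rewrite diamT in dl.
(* Three times the count is at least [3 * (l %/ 3) + 3], hence at least [l + 1] and [d + 1]. *)
move=> count_gt; rewrite ler_pdivrMr ?ltr0n // natr1 -natrM ler_nat; lia.
Qed.
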